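(* Let $S=\{0,1,2\}$ and $s_0=0$. Then every colouring of $\mathbb{Q}$ with finitely many colours and using more than one colour contains an almost-monochromatic positive homothet of $(S,s_0)$; that is, there exist $a\in\mathbb{Q}$ and $\lambda\in\mathbb{Q}_{>0}$ such that $a+\lambda$ and $a+2\lambda$ have the same colour while $a$ has a different colour.
   Context: A positive homothet of $(S,s_0)$ is $(c+\lambda S, c+\lambda s_0)$ with $\lambda>0$; it is almost-monochromatic if $(c+\lambda S)\setminus\{c+\lambda s_0\}$ is monochromatic but $c+\lambda S$ is not. *)

(* Defs.v *)
From mathcomp Require Import all_boot all_order all_algebra.
From mathcomp Require Import boolp classical_sets.

Set Implicit Arguments.
Unset Strict Implicit.
Unset Printing Implicit Defensive.

Import Order.TTheory GRing.Theory Num.Theory.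
Local Open Scope classical_set_scope.
Local Open Scope ring_scope.

Definition homothety (R : numDomainType) (c l x : R) : R := c + l * x.

Definition homothet (R : numDomainType) (c l : R) (S : set R) : set R :=
  homothety c l @` S.

Definition monochromatic (X C : Type) (chi : X -> C) (A : set X) : Prop :=
  forall x y, A x -> A y -> chi x = chi y.

Definition almost_monochromatic (X C : Type) (chi : X -> C)
    (A : set X) (a0 : X) : Prop :=
  monochromatic chi (A `\ a0) /\ ~ monochromatic chi A.

(* Main.v *)
(* Without an almost-monochromatic homothet, each colour class is closed under
   (x, y) |-> 2x - y for x < y, hence contains the descending progression
   through any two of its points. On a lattice (1/n)Z a class with two points
   therefore lies in a single coset of some dZ and, far enough down, is all of
   it. By pigeonhole some colour c contains two points at distance 1/n for
   every n, so it meets every descending progression of Q. Two points of any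
   other colour would span a descending progression avoiding c, so every other
   colour is used at most once and c takes over above some bound B; reflecting
   large points of colour c then gives colour c to every rational. *)

Require Import Defs.
From mathcomp Require Import all_boot all_order all_algebra.
From mathcomp Require Import boolp classical_sets.
From mathcomp Require Import zify ring lra.

Set Implicit Arguments.
Unset Strict Implicit.
Unset Printing Implicit Defensive.

Import Order.TTheory GRing.Theory Num.Theory.
Local Open Scope classical_set_scope.
Local Open Scope ring_scope.

(** Imposed on every colour class, this excludes almost-monochromatic homothets: [2 * x - y], [x],
    [y] are equally spaced. *)
Definition reflection_closed (R : numDomainType) (A : R -> Prop) : Prop :=
  forall x y, x < y -> A x -> A y -> A (2 * x - y).

Lemma reflection_closed_progression (R : realDomainType) (A : R -> Prop) x y :
  reflection_closed A -> x < y -> A x -> A y ->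
  forall k : nat, A (y - (y - x) * k%:R).
Proof.
move=> clA ltxy Ax Ay k.
suff [] : A (y - (y - x) * k%:R) /\ A (y - (y - x) * k.+1%:R) by [].
elim: k => [|k [IHk IHk1]].
  by rewrite mulr0 mulr1 subr0 opprB addrC subrK.
split=> //.
have -> : y - (y - x) * k.+2%:R =
    2 * (y - (y - x) * k.+1%:R) - (y - (y - x) * k%:R).
  by rewrite -!natr1; ring.
by apply: clA => //; rewrite -natr1; lra.
Qed.

(* Descent on [y - x]: a point of [A] outside [y + dZ] can be moved below [y],
   where it falls strictly between two terms of the progression. *)
Lemma reflection_closed_int (A : int -> Prop) x y :
  reflection_closed A -> x < y -> A x -> A y ->
  exists d y0, [/\ 0 < d, forall k : nat, A (y0 - d * k%:R) &
                   forall z, A z -> (d %| z - y0)%Z].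
Proof.
move=> clA; have [n] := ubnP `|y - x|%N.
elim: n x y => // n IHn x y ltn ltxy Ax Ay.
have APd := reflection_closed_progression clA ltxy Ax Ay.
set d := y - x in ltn APd; have d_gt0 : 0 < d by rewrite subr_gt0.
case: (pselect (forall z, A z -> (d %| z - y)%Z)) => [dvdA|]; first by exists d, y.
move=> /existsNP[z /not_implyP[Az /negP Ndz]].
have [w [Aw Ndw ltwy]] : exists w, [/\ A w, ~~ (d %| w - y)%Z & w < y].
  have [ltzy|leyz] := ltP z y; first by exists z.
  (* Reflect [z] in a term of the progression far below it. *)
  pose k := `|z - y|.+1%N.
  have k_gt : y - d * k%:R < z by rewrite /k; nia.
  exists (2 * (y - d * k%:R) - z); split; first exact: clA.
    apply: contra Ndz => /dvdzP[q Eq]; apply/dvdzP; exists (- q - 2 * k%:R).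
    by rewrite mulrBl mulNr -Eq; ring.
  by rewrite /k; nia.
(* The pair [w], [y - d * q] has difference [r] with [0 < r < d], so the induction hypothesis
   applies to it. *)
pose q := ((y - w) %/ d)%Z; pose r := ((y - w) %% d)%Z.
have Eyw : y - w = q * d + r by exact: divz_eq.
have r_ge0 : 0 <= r by apply: modz_ge0; lia.
have r_lt : r < d by exact: ltz_pmod.
have r_neq0 : r != 0.
  by apply: contra Ndw => /eqP r0; apply/dvdzP; exists (- q); lia.
have q_ge0 : 0 <= q by rewrite /q divz_ge0 //; lia.
have Eq : (`|q|%N%:R : int) = q by lia.
apply: (IHn w (y - d * `|q|%N%:R)) => //; rewrite ?Eq; lia.
Qed.

Lemma rat_common_denominator (s : seq rat) :
  exists2 n : nat, (0 < n)%N &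
    forall x, x \in s -> exists p : int, x = p%:~R / n%:R.
Proof.
elim: s => [|x s [n n_gt0 IHs]]; first by exists 1%N.
exists (`|denq x| * n)%N; first by rewrite muln_gt0 absz_gt0 denq_neq0.
have n0 : n%:R != 0 :> rat by rewrite pnatr_eq0 -lt0n.
have d0 : (`|denq x|%N%:R : rat) != 0 by rewrite pnatr_eq0 absz_eq0 denq_neq0.
move=> u; rewrite inE => /orP[/eqP-> | /IHs[p ->]].
  exists (numq x * n%:Z); rewrite -{1}[x]divq_num_den intrM natrM.
  have -> : (denq x)%:~R = `|denq x|%N%:R :> rat by rewrite pmulrn absz_denq.
  by rewrite -pmulrn; field; rewrite d0 n0.
exists (p * `|denq x|%N%:Z); rewrite intrM natrM -pmulrn.
by field; rewrite d0 n0.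
Qed.

Section Colouring.

Variables (C : finType) (chi : rat -> C).
Hypothesis closed_chi : forall c, reflection_closed (fun x => chi x = c).

(** If each colour [c] missed a step [1 / f c], pigeonhole on a fine lattice would give two nearby
    points of one colour, whose progression realises that step. *)
Lemma colour_with_all_steps :
  exists c, forall n : nat, (0 < n)%N ->
    exists z, chi z = c /\ chi (z - n%:R^-1) = c.
Proof.
apply/not_existsP => bad.
have /choice[f fP] : forall c, exists n : nat, (0 < n)%N /\
    forall z, chi z = c -> chi (z - n%:R^-1) <> c.
  move=> c; have /existsNP[n /not_implyP[n_gt0 nP]] := bad c.
  exists n; split=> // z zc znc; apply: nP; by exists z.
have f_gt0 c : (0 < f c)%N by case: (fP c).
have [N N_gt0 NP] : exists2 N, (0 < N)%N &
    forall c i, (0 < i <= #|C|)%N -> (i * f c %| N)%N.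
  exists (#|C| `! * \prod_c f c)%N.
    by rewrite muln_gt0 fact_gt0 prodn_gt0.
  by move=> c i leiC; rewrite dvdn_mul ?dvdn_fact // (bigD1 c) //= dvdn_mulr.
pose g (i : 'I_#|C|.+1) := chi (- (i%:R / N%:R)).
have [i [j [ltij Egij]]] : exists i j : 'I_#|C|.+1, (i < j)%N /\ g i = g j.
  have /injectivePn[i [j neij Eg]] : ~~ injectiveb g.
    by apply/injectiveP => /leq_card; rewrite card_ord ltnn.
  have := neij; rewrite -val_eqE neq_ltn => /orP[?|?]; first by exists i, j.
  by exists j, i.
set c := g i in Egij; have [_ /(_ (- (i%:R / N%:R)))] := fP c.
apply=> //.
(* Exactly [k] gaps of length [(j - i) / N] make up [1 / f c]. *)
have /dvdnP[k Ek] : ((j - i) * f c %| N)%N.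
  by apply: NP; rewrite subn_gt0 ltij leq_subLR; have := ltn_ord j; lia.
have lt0 : - (j%:R / N%:R) < - (i%:R / N%:R) :> rat.
  by rewrite ltrN2 ltr_pM2r ?invr_gt0 ?ltr_nat ?ltr0n.
have := reflection_closed_progression (@closed_chi c) lt0 (esym Egij) erefl k.
congr (chi (_ - _) = _).
have N0 : N%:R != 0 :> rat by rewrite pnatr_eq0 -lt0n.
have fc0 : (f c)%:R != 0 :> rat by rewrite pnatr_eq0 -lt0n.
have -> : (f c)%:R^-1 = k%:R * (j%:R - i%:R) / N%:R :> rat.
  apply: (mulIf N0); rewrite divfK // Ek !natrM natrB 1?ltnW //.
  by field; rewrite fc0.
by field; rewrite N0.
Qed.

(** In units of [1 / (n * m)], the pair [z], [z - 1 / n] forces [d] to divide [m]. All of (1/n)Z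
    then lies in the coset of [a], which colour [c] fills from [y0] downwards. *)
Lemma dominant_colour :
  exists c, forall y h, 0 < h -> exists k : nat, chi (y - h * k%:R) = c.
Proof.
have [c cP] := colour_with_all_steps; exists c => y h h_gt0.
have [a [Ea _]] := cP 1%N isT.
have [n n_gt0 nP] := rat_common_denominator [:: y; h; a].
have [z [Ez Ezn]] := cP n n_gt0.
(* [z] depends on [n] and need not lie in (1/n)Z, hence a second denominator. *)
have [m m_gt0 mP] := rat_common_denominator [:: z].
have [Y EY] : exists p : int, y = p%:~R / n%:R by apply: nP; rewrite !inE eqxx.
have [H EH] : exists p : int, h = p%:~R / n%:R.
  by apply: nP; rewrite !inE eqxx orbT.
have [U EU] : exists p : int, a = p%:~R / n%:R.
  by apply: nP; rewrite !inE eqxx !orbT.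
have [Z EZ] : exists p : int, z = p%:~R / m%:R by apply: mP; rewrite !inE eqxx.
have n0 : n%:R != 0 :> rat by rewrite pnatr_eq0 -lt0n.
have m0 : m%:R != 0 :> rat by rewrite pnatr_eq0 -lt0n.
pose s (i : int) : rat := i%:~R / (n%:R * m%:R).
have nm_gt0 : 0 < n%:R * m%:R :> rat by rewrite mulr_gt0 ?ltr0n.
pose A i := chi (s i) = c.
have clA : reflection_closed A.
  move=> i j ltij Ai Aj; rewrite /A.
  have -> : s (2 * i - j) = 2 * s i - s j by rewrite /s intrB intrM; ring.
  by apply: closed_chi => //; rewrite ltr_pM2r ?invr_gt0 // ltr_int.
have sm (p : int) : s (p * m%:R) = p%:~R / n%:R.
  by rewrite /s intrM natz -pmulrn; field; rewrite n0 m0.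
have AZ : A (Z * n%:R).
  have -> // : A (Z * n%:R) = (chi z = c).
  by rewrite /A /s intrM natz -pmulrn EZ; congr (chi _ = _); field; rewrite n0 m0.
have AZm : A (Z * n%:R - m%:R).
  have -> // : A (Z * n%:R - m%:R) = (chi (z - n%:R^-1) = c).
  rewrite /A /s intrB intrM !natz -!pmulrn EZ; congr (chi _ = _).
  by field; rewrite n0 m0.
have AU : A (U * m%:R) by rewrite /A sm -EU.
have ltZ : Z * n%:R - m%:R < Z * n%:R by rewrite ltrBlDr ltrDl ltr0n.
have [d [y0 [d_gt0 APd dvdA]]] := reflection_closed_int clA ltZ AZm AZ.
have H_gt0 : 0 < H.
  by move: h_gt0; rewrite EH pmulr_lgt0 ?invr_gt0 ?ltr0n // ltr0z.
have dm : (d %| m%:R)%Z.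
  have -> : m%:R = (Z * n%:R - y0) - (Z * n%:R - m%:R - y0) :> int by ring.
  by rewrite rpredB // dvdA.
have /dvdzP[q Eq] : (d %| Y * m%:R - y0)%Z.
  have -> : Y * m%:R - y0 = (U * m%:R - y0) + (Y - U) * m%:R by ring.
  by rewrite rpredD ?dvdA // dvdz_mull.
have /dvdzP[t Et] : (d %| H * m%:R)%Z by rewrite dvdz_mull.
have t_gt0 : 0 < t.
  have : 0 < t * d by rewrite -Et mulr_gt0 // ltr0n.
  by rewrite pmulr_lgt0.
(* In lattice units [y] is [y0 + q * d] and [h] is [t * d] with [t >= 1], so [|q|] steps reach [y0]
   or below; [e] counts the terms passed. *)
exists `|q|%N.
pose e : int := t * `|q|%N%:Z - q.
have e_ge0 : 0 <= e by rewrite /e; nia.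
have := APd `|e|%N; rewrite natz gez0_abs // /e.
have -> : y0 - d * (t * `|q|%N%:Z - q) = (Y - H * `|q|%N%:Z) * m%:R.
  by rewrite mulrBl mulrAC Et -[Y * _](subrK y0) Eq; ring.
rewrite /A sm EY EH => <-; congr chi.
by rewrite intrB intrM -pmulrn; field.
Qed.

Lemma closed_colouring_constant x y : chi x = chi y.
Proof.
have [c cP] := dominant_colour.
have inj u v : chi u <> c -> chi u = chi v -> u < v -> False.
  move=> uc Euv ltuv; have [k Ek] := cP v (v - u) ltac:(by rewrite subr_gt0).
  apply: uc; rewrite Euv -Ek; symmetry.
  exact: (reflection_closed_progression (@closed_chi (chi v)) ltuv Euv erefl).
have /choice[M MP] : forall c', exists M, forall u,
    chi u = c' -> c' <> c -> u <= M.
  move=> c'; case: (pselect (exists v, chi v = c')) => [[v Ev]|N].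
    exists v => u Eu c'c; rewrite leNgt; apply/negP.
    by apply: inj; rewrite Ev.
  by exists 0 => u Eu; case: N; exists u.
pose B := \sum_c' `|M c'|.
have large u : B < u -> chi u = c.
  move=> ltBu; apply: contrapT => uc.
  have := MP (chi u) u erefl uc; apply/negP; rewrite -ltNge.
  apply: le_lt_trans ltBu; rewrite (le_trans (ler_norm _)) // /B.
  by rewrite (bigD1 (chi u)) //= lerDl sumr_ge0.
have B_ge0 : 0 <= B by rewrite sumr_ge0.
suff all_c u : chi u = c by rewrite !all_c.
(* This puts both [u + l] and [u + 2 * l] above [B]. *)
pose l := B + `|u| + 1.
have ? : - u <= `|u| by rewrite -normrN ler_norm.
have ? : 0 <= `|u| by [].
have -> : u = 2 * (u + l) - (u + 2 * l) by ring.
by apply: closed_chi; [|apply: large..]; rewrite /l; lra.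
Qed.

End Colouring.

Theorem theorem1p6 (C : finType) (chi : rat -> C)
    (chi_nonconstant : exists x y : rat, chi x <> chi y) :
  exists a l : rat,
    [/\ 0 < l,
        almost_monochromatic chi (homothet a l [set 0; 1; 2])
                                 (homothety a l 0)
      & chi (a + l) = chi (a + 2 * l) /\ chi a <> chi (a + l)].
Proof.
(* The explicit triple suffices: without [a] the homothet is [a + l], [a + 2 * l]. *)
suff [a [l [l_gt0 E12 N01]]] :
    exists a l, [/\ 0 < l, chi (a + l) = chi (a + 2 * l) & chi a <> chi (a + l)].
  exists a, l; split=> //; split.
    have colour u : (homothet a l [set 0; 1; 2] `\ homothety a l 0) u ->
        chi u = chi (a + l).
      case=> -[t /= [[->|->]|->] <-]; rewrite /homothety ?mulr1 //.
      by rewrite E12 [l * 2]mulrC.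
    by move=> u v /colour-> /colour->.
  move=> mono; apply: N01; apply: mono.
    by exists 0; [left; left | rewrite /homothety mulr0 addr0].
  by exists 1; [left; right | rewrite /homothety mulr1].
apply: contrapT => noAM; case: chi_nonconstant => x [y]; apply.
apply: closed_colouring_constant => c u v ltuv Eu Ev.
apply: contrapT => Nuv; apply: noAM; exists (2 * u - v), (v - u).
have -> : 2 * u - v + (v - u) = u by ring.
have -> : 2 * u - v + 2 * (v - u) = v by ring.
by rewrite subr_gt0 Eu Ev.
Qed.
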